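(* Let $\Omega$ be a probability distribution on a finite set $\mathfrak U$, let $\mathcal A$ be a finite collection of events (subsets of $\mathfrak U$) equipped with a symmetric relation $\sim$ (possibly $A \sim A$), and let $r$ be a resampling oracle for $\mathcal A$. Let $\overline{\mathcal A}$, its relation $\sim$, and the oracle $\overline r$ be the atomically-generated extension defined in the context. If $r$ satisfies properties (C1), (C2), (C4) for the events $\mathcal A$ on the space $\Omega$, then $\overline r$ satisfies (C1), (C2), (C4) for the events $\overline{\mathcal A}$ on the space $\Omega$. If, in addition, $r$ satisfies property (C3) for the events $\mathcal A$, then $\overline r$ also satisfies (C3) for the events $\overline{\mathcal A}$.
   Context: For $V \subseteq \mathfrak U$ with $\Omega[V]>0$, $\Omega^V$ denotes $\Omega$ conditioned on $V$, i.e. $\Omega^V[u]=\Omega[u]/\Omega[V]$ for $u\in V$. A resampling oracle for a family $\mathcal F$ of events with symmetric relation $\sim$ consists of, for each $F \in \mathcal F$, a probability distribution $Y_F$ on a finite set (also called $Y_F$) and a deterministic map sending a state $u \in F$ and $y \in Y_F$ to a state $yu := r_F(u,y) \in \mathfrak U$. For $F \not\sim F'$, let $Y_{F;F'} = \{ y \in Y_F : yu \in F' \text{ for all } u \in F \cap F'\}$. Properties: (C1) for every $F \in \mathcal F$ and $u \in \mathfrak U$: $P_{(U,y)\approx \Omega^F \times Y_F}(yU = u) = \Omega[u]$. (C2) if $F \not\sim F'$ and $u \in F \setminus F'$, then $yu \notin F'$ for all $y \in Y_F$. (C3) if $F\not\sim F'$, then for all $u \in F\cap F'$ and $w \in \mathfrak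 U$: $P_{(y,y')\approx Y_F\times Y_{F'}}(y'yu = w \mid yu \in F') = P_{(y,y')\approx Y_F\times Y_{F'}}(yy'u = w \mid y'u \in F)$. (C4) if $F\not\sim F'$, then for all $y\in Y_F$: $P_{U \approx \Omega^{F\cap F'}}(yU \in F') \in \{0,1\}$. Atomic extension: a set $E \subseteq \mathcal A$ is independent if $A \not\sim A'$ for all distinct $A, A' \in E$; write $\langle E \rangle = \bigcap_{A\in E} A$. Let $\overline{\mathcal A} = \{\langle E\rangle : E \text{ an independent subset of } \mathcal A\}$, and set $\langle E\rangle \sim \langle E'\rangle$ iff there exist $A\in E$, $A'\in E'$ with $A\sim A'$. For $A \in \mathcal A$ and $E\subseteq\mathcal A$ with $A \not\sim A'$ for all $A'\in E$, let $Y_{A;E} = \bigcap_{A'\in E} Y_{A;A'}$, viewed as the distribution $Y_A$ conditioned on this subset. For $C = \langle E\rangle$, fix an arbitrary ordering $E = \{A_1,\dots,A_k\}$ and let $Y_C = Y_{A_1;\{A_2,\dots,A_k\}} \times Y_{A_2;\{A_3,\dots,A_k\}}\times\dots\times Y_{A_k}$ (independent coordinates), with $\overline r_C(u,(y_1,\dots,y_k)) = y_k y_{k-1}\cdots y_1 u$.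
   Formalization: The formal theorem assumes that Ω[u] > 0 for every state u (the state space is the support of Ω); with null states allowed the claim as literally written fails, since (C4) ignores null states while Y_{F;F'} sees them. *)

(* Defs.v *)
From mathcomp Require Import all_boot all_order all_algebra.

Set Implicit Arguments.
Unset Strict Implicit.
Unset Printing Implicit Defensive.

Import Order.TTheory GRing.Theory Num.Theory.
Local Open Scope ring_scope.

Section Distributions.
Variable R : realFieldType.

Definition is_distr (T : finType) (p : T -> R) : Prop :=
  (forall x, 0 <= p x) /\ \sum_x p x = 1.

Definition Pr (T : finType) (p : T -> R) (P : pred T) : R :=
  \sum_(x | P x) p x.

(* The conditioned distribution and the conditional probability below use
   division in [R], where [x / 0 = 0].  No side condition is therefore needed
   when the conditioning event is null; in particular [C1] below cannot hold
   for a null event [F], since its left-hand side would be 0 for every [u]. *)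
Definition cond (T : finType) (p : T -> R) (V : {set T}) : T -> R :=
  fun x => if x \in V then p x / Pr p (mem V) else 0.

Definition condPr (T : finType) (p : T -> R) (P Q : pred T) : R :=
  Pr p (predI P Q) / Pr p Q.

Definition prod_distr (T1 T2 : finType) (p : T1 -> R) (q : T2 -> R) :
    T1 * T2 -> R :=
  fun z => p z.1 * q z.2.

End Distributions.

(* A collection of events on the state space [S] is given as a family
   [ev : I -> {set S}] with a relation on the index type [I].  The relation
   and the oracle of the atomic extension depend on the set [E], not only on
   the event [<E>], so events have to be named by indices. *)

(* [ospace r F] and [omass r F] are the finite set Y_F and its distribution,
   and [oact r F u y] is the state yu = r_F(u, y).  It is total in [u], but its
   values for [u] outside the event [F] are irrelevant: all the notions below
   evaluate it on the event only. *)
Record oracle (R : realFieldType) (S I : finType) := Oracle {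
  ospace : I -> finType;
  omass : forall F : I, ospace F -> R;
  oact : forall F : I, S -> ospace F -> S
}.

Definition is_oracle (R : realFieldType) (S I : finType) (r : oracle R S I) :
    Prop :=
  forall F : I, is_distr (@omass _ _ _ r F).

Section Properties.
Variables (R : realFieldType) (S I : finType).
Variables (Omega : S -> R) (ev : I -> {set S}) (sim : rel I).
Variable r : oracle R S I.

Definition C1 : Prop := forall (F : I) (u : S),
  Pr (prod_distr (cond Omega (ev F)) (@omass _ _ _ r F))
     (fun z => oact z.1 z.2 == u) = Omega u.

Definition C2 : Prop := forall F F' : I, ~~ sim F F' ->
  forall u, u \in ev F :\: ev F' ->
  forall y : ospace r F, oact u y \notin ev F'.

(* The sample is z = (y, y'). *)
Definition C3 : Prop := forall F F' : I, ~~ sim F F' ->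
  forall u, u \in ev F :&: ev F' -> forall w : S,
  condPr (prod_distr (@omass _ _ _ r F) (@omass _ _ _ r F'))
         (fun z => oact (oact u z.1) z.2 == w)
         (fun z => oact u z.1 \in ev F')
  = condPr (prod_distr (@omass _ _ _ r F) (@omass _ _ _ r F'))
           (fun z => oact (oact u z.2) z.1 == w)
           (fun z => oact u z.2 \in ev F).

Definition C4 : Prop := forall F F' : I, ~~ sim F F' ->
  forall y : ospace r F,
  let p := Pr (cond Omega (ev F :&: ev F')) (fun u => oact u y \in ev F') in
  p = 0 \/ p = 1.

End Properties.

Section AtomicExtension.
Variables (R : realFieldType) (S I : finType).
Variables (ev : I -> {set S}) (sim : rel I).
Variable r : oracle R S I.

Definition independent (E : {set I}) : bool :=
  [forall A in E, forall A' in E, (A != A') ==> ~~ sim A A'].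

Definition atomic_idx : finType := {E : {set I} | independent E}.

Definition atomic_ev (C : atomic_idx) : {set S} := \bigcap_(A in val C) ev A.

Definition atomic_sim : rel atomic_idx :=
  fun C C' => [exists A in val C, exists A' in val C', sim A A'].

(* Y_{A;A'} *)
Definition keep (A A' : I) : {set ospace r A} :=
  [set y | [forall u in ev A :&: ev A', oact u y \in ev A']].

(* Y_{A;E}, for E the set of the items of [s] *)
Definition keep_all (A : I) (s : seq I) : {set ospace r A} :=
  \bigcap_(A' in s) keep A A'.

Fixpoint seq_space (s : seq I) : finType :=
  if s is A :: s' then ({y : ospace r A | y \in keep_all A s'} * seq_space s')%type
  else unit.

Fixpoint seq_mass (s : seq I) : seq_space s -> R :=
  if s is A :: s' then
    prod_distr (fun y => cond (@omass _ _ _ r A) (keep_all A s') (val y))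
               (@seq_mass s')
  else fun=> 1.

Fixpoint seq_act (s : seq I) : S -> seq_space s -> S :=
  if s is A :: s' then fun u z => seq_act (oact u (val z.1)) z.2
  else fun u _ => u.

(* [ord C] is the chosen ordering of the set [E] underlying [C = <E>]. *)
Definition atomic_oracle (ord : atomic_idx -> seq I) : oracle R S atomic_idx :=
  @Oracle R S atomic_idx (fun C => seq_space (ord C))
    (fun C => @seq_mass (ord C)) (fun C => @seq_act (ord C)).

End AtomicExtension.

(* Main.v *)
Require Import Defs.
From mathcomp Require Import all_boot all_order all_algebra.

Set Implicit Arguments.
Unset Strict Implicit.
Unset Printing Implicit Defensive.

Import Order.TTheory GRing.Theory Num.Theory.
Local Open Scope ring_scope.

(* Because [Omega] charges every state, (C2) and (C4) make staying inside
   independent events a product condition: for [u] in [A], the state [yu] lies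
   in [<E>] iff [u] lies in [<E>] and [y] lies in [Y_{A;E}].  Hence (C1) for [A],
   restricted to [<E>], says that resampling [A] with [Y_{A;E}] turns
   [Omega^{A :&: <E>}] into [Omega^{<E>}]; iterating gives (C1) for [<E>].
   Conditioning a run through [C] on ending in [C'] amounts to running through
   the concatenation of the two orderings with the corresponding sets
   [Y_{A;E}], so (C3) reduces to invariance of the law of a run under swapping
   adjacent items, which is (C3) for two atoms. *)

(** * Sums over finite distributions *)

Section FiniteDistributions.
Variable R : realFieldType.

Lemma PrE (T : finType) (p : T -> R) (P : pred T) :
  Pr p P = \sum_x p x * (P x)%:R.
Proof.
by rewrite /Pr big_mkcond; apply: eq_bigr => x _; case: (P x); rewrite ?mulr1 ?mulr0.
Qed.

Lemma Pr_ge0 (T : finType) (p : T -> R) (P : pred T) :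
  (forall x, 0 <= p x) -> 0 <= Pr p P.
Proof. by move=> p_ge0; apply: sumr_ge0. Qed.

Lemma sum_comp (T S : finType) (p : T -> R) (X : T -> S) (f : S -> R) :
  \sum_z p z * f (X z) = \sum_w Pr p (fun z => X z == w) * f w.
Proof.
rewrite (partition_big X predT) //=; apply: eq_bigr => w _.
by rewrite /Pr mulr_suml; apply: eq_bigr => z /eqP ->.
Qed.

Lemma sum_cond (T : finType) (p : T -> R) (V : {set T}) (f : T -> R) :
  \sum_x cond p V x * f x = (\sum_(x in V) p x * f x) / Pr p (mem V).
Proof.
rewrite mulr_suml [RHS]big_mkcond; apply: eq_bigr => x _; rewrite /cond.
by case: ifP => _; rewrite ?mul0r // mulrAC.
Qed.

Lemma cond_distr (T : finType) (p : T -> R) (V : {set T}) :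
  (forall x, 0 <= p x) -> 0 < Pr p (mem V) -> is_distr (cond p V).
Proof.
move=> p_ge0 V_gt0; split=> [x|].
  by rewrite /cond; case: ifP => // _; rewrite divr_ge0 // ltW.
under eq_bigr do rewrite -[cond _ _ _]mulr1.
rewrite sum_cond; under eq_bigr do rewrite mulr1.
by rewrite divff // gt_eqF.
Qed.

(** (C3) compares the two orders of a pair of events; this relabels the sample when their roles are
    exchanged. *)
Lemma Pr_prod_swap (T1 T2 : finType) (p : T1 -> R) (q : T2 -> R)
    (P : pred (T1 * T2)) :
  Pr (prod_distr q p) (fun z => P (z.2, z.1)) = Pr (prod_distr p q) P.
Proof.
rewrite !PrE -(pair_bigA _ (fun y x => q y * p x * (P (x, y))%:R)) exchange_big /=.
transitivity (\sum_z p z.1 * q z.2 * (P (z.1, z.2))%:R); last by apply: eq_bigr => -[].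
rewrite -(pair_bigA _ (fun x y => p x * q y * (P (x, y))%:R)) /=.
by apply: eq_bigr => x _; apply: eq_bigr => y _; rewrite [q y * _]mulrC.
Qed.

End FiniteDistributions.

(** * Runs through a list of events, and a single resampling step *)

Section SequentialResampling.
Variables (R : realFieldType) (S I : finType).
Variables (Omega : S -> R) (ev : I -> {set S}) (sim : rel I).
Variable r : oracle R S I.
Hypothesis Omega_distr : is_distr Omega.
Hypothesis Omega_pos : forall u : S, 0 < Omega u.
Hypothesis sim_sym : symmetric sim.
Hypothesis r_oracle : is_oracle r.
Hypothesis r_C1 : C1 Omega ev r.
Hypothesis r_C2 : C2 ev sim r.
Hypothesis r_C4 : C4 Omega ev sim r.

Local Notation Y A := (ospace r A).
Local Notation mass A := (@omass R S I r A).
Local Notation keeps A s := (@keep_all R S I ev r A s).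
Local Notation nsim := (fun A B : I => ~~ sim A B).

Definition meet (s : seq I) : {set S} := [set u | all (fun A => u \in ev A) s].

(* [run s f u] is the expectation of [f] at the final state of a run from [u]. *)
Fixpoint run (s : seq I) (f : S -> R) (u : S) : R :=
  if s is A :: s' then
    \sum_y cond (mass A) (keeps A s') y * run s' f (oact u y)
  else f u.

Lemma in_meet_cons A s u : (u \in meet (A :: s)) = (u \in ev A) && (u \in meet s).
Proof. by rewrite !inE. Qed.

Lemma in_meet_cat s t u : (u \in meet (s ++ t)) = (u \in meet s) && (u \in meet t).
Proof. by rewrite !inE all_cat. Qed.

Lemma meet_nil : meet [::] = setT.
Proof. by apply/setP => u; rewrite !inE. Qed.

Lemma meetP s u : reflect (forall A, A \in s -> u \in ev A) (u \in meet s).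
Proof. by rewrite inE; apply: allP. Qed.

Lemma in_keep_all A s (y : Y A) :
  (y \in keeps A s) = all (fun B => y \in @keep R S I ev r A B) s.
Proof.
by apply/bigcapP/allP.
Qed.

Lemma keep_all_cat A s t : keeps A (s ++ t) = keeps A s :&: keeps A t.
Proof. by apply/setP => y; rewrite inE !in_keep_all all_cat. Qed.

Lemma keep_all_mem A s t : s =i t -> keeps A s = keeps A t.
Proof.
by move=> st; apply/setP => y; rewrite !in_keep_all; apply: eq_all_r.
Qed.

Lemma Pr_Omega_gt0 (V : {set S}) u : u \in V -> 0 < Pr Omega (mem V).
Proof.
move=> uV; rewrite /Pr (bigD1 u) //= ltr_wpDr //.
by apply: sumr_ge0 => v _; apply: ltW.
Qed.

(** For an empty event the left-hand side of (C1) is 0, while [Omega] is positive at some state,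
    which exists because [Omega] sums to 1. *)
Lemma ev_gt0 A : 0 < Pr Omega (mem (ev A)).
Proof.
have [u uA|A0] := pickP (mem (ev A)); first exact: Pr_Omega_gt0 uA.
have [u _|S0] := pickP S; last first.
  case: Omega_distr => _; rewrite big_pred0 => [/esym/eqP|u]; last exact: S0.
  by rewrite oner_eq0.
have := Omega_pos u; rewrite -(r_C1 A u) /Pr big1 ?ltxx // => z _.
by rewrite /prod_distr /cond [_ \in _]A0 mul0r.
Qed.

(* Since [Omega] charges every state, (C4) is a pointwise dichotomy. *)
Lemma oact_ev A B u (y : Y A) : ~~ sim A B -> u \in ev A ->
  (oact u y \in ev B) = (u \in ev B) && (y \in @keep R S I ev r A B).
Proof.
move=> nAB uA; have [uB|uB] /= := boolP (u \in ev B); last first.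
  by apply/negbTE/(r_C2 nAB); rewrite inE uB.
have uAB : u \in ev A :&: ev B by rewrite inE uA.
apply/idP/idP; last by rewrite inE => /forall_inP; apply.
move=> yuB; rewrite inE; apply/forall_inP => v vAB.
have V_gt0 := Pr_Omega_gt0 uAB.
pose V := ev A :&: ev B.
have cond_ge0 w : 0 <= cond Omega V w.
  by rewrite /cond; case: ifP => // _; rewrite divr_ge0 ?(ltW V_gt0) // ltW.
have cond_gt0 w : w \in V -> 0 < cond Omega V w.
  by move=> wV; rewrite /cond wV divr_gt0.
(* Every state of [V] has positive conditional mass: probability 0 is refuted by [u], and
   probability 1 leaves no room for an exceptional [v]. *)
case: (r_C4 nAB y) => [/eqP|p1].
  rewrite /Pr psumr_eq0 //= => /allP /(_ u); rewrite mem_index_enum => /(_ isT).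
  by rewrite yuB /= gt_eqF // cond_gt0.
have : Pr (cond Omega V) (fun w => oact w y \notin ev B) = 0.
  have [_] := cond_distr (fun w => ltW (Omega_pos w)) V_gt0.
  rewrite (bigID (fun w => oact w y \in ev B)) /=.
  rewrite -[X in X + _ = _]/(Pr (cond Omega V) (fun w => oact w y \in ev B)).
  by rewrite /V p1 -[RHS]addr0 => /addrI.
move/eqP; rewrite /Pr psumr_eq0 // => /allP /(_ v); rewrite mem_index_enum => /(_ isT).
by rewrite gt_eqF ?cond_gt0 // implybF negbK.
Qed.

Lemma oact_meet A s u (y : Y A) : all (nsim A) s -> u \in ev A ->
  (oact u y \in meet s) = (u \in meet s) && (y \in keeps A s).
Proof.
move=> + uA; rewrite in_keep_all !inE; elim: s => //= B s IHs /andP[nAB nAs].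
by rewrite IHs // oact_ev // andbACA.
Qed.

(** Passing from point masses to test functions lets (C1) be composed with later resampling
    steps. *)
Lemma C1_sum A (h : S -> R) :
  \sum_(u in ev A) \sum_y Omega u * mass A y * h (oact u y)
  = Pr Omega (mem (ev A)) * \sum_u Omega u * h u.
Proof.
have A_neq0 : Pr Omega (mem (ev A)) != 0 by rewrite gt_eqF ?ev_gt0.
apply: (mulIf (invr_neq0 A_neq0)); rewrite [RHS]mulrAC divff // mul1r.
transitivity (\sum_z prod_distr (cond Omega (ev A)) (mass A) z * h (oact z.1 z.2)).
  rewrite -(pair_bigA _ (fun u y => cond Omega (ev A) u * mass A y * h (oact u y))).
  rewrite mulr_suml [LHS]big_mkcond; apply: eq_bigr => u _; rewrite /cond.
  case: ifP => _; last by rewrite big1 // => y _; rewrite !mul0r.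
  rewrite mulr_suml; apply: eq_bigr => y _.
  by rewrite mulrAC; congr (_ * _); rewrite mulrAC.
by rewrite sum_comp; apply: eq_bigr => w _; rewrite r_C1.
Qed.

(** This is [C1_sum] for [g] cut off to [meet s]: by [oact_meet] the cut-off splits into a condition
    on [u] and one on [y]. *)
Lemma resample_sum A s (g : S -> R) : all (nsim A) s ->
  \sum_(u in meet (A :: s)) \sum_(y in keeps A s) Omega u * mass A y * g (oact u y)
  = Pr Omega (mem (ev A)) * \sum_(u in meet s) Omega u * g u.
Proof.
move=> nAs; transitivity
    (Pr Omega (mem (ev A)) * \sum_u Omega u * ((u \in meet s)%:R * g u)).
  rewrite -C1_sum big_mkcond [RHS]big_mkcond; apply: eq_bigr => u _.
  rewrite in_meet_cons; case: (boolP (u \in ev A)) => //= uA.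
  case: ifP => us.
    rewrite big_mkcond; apply: eq_bigr => y _; rewrite oact_meet // us /=.
    by case: ifP => _; rewrite ?mul1r // mul0r mulr0.
  by rewrite big1 // => y _; rewrite oact_meet // us /= mul0r mulr0.
congr (_ * _); rewrite [RHS]big_mkcond; apply: eq_bigr => u _.
by case: ifP => _; rewrite ?mul1r // mul0r mulr0.
Qed.

Lemma resample_Pr A s : all (nsim A) s ->
  Pr Omega (mem (meet (A :: s))) * Pr (mass A) (mem (keeps A s))
  = Pr Omega (mem (ev A)) * Pr Omega (mem (meet s)).
Proof.
move=> /(resample_sum (fun=> 1)) H.
transitivity (Pr Omega (mem (ev A)) * \sum_(u in meet s) Omega u * 1).
  rewrite -H /Pr mulr_suml; apply: eq_bigr => u _.
  by rewrite mulr_sumr; apply: eq_bigr => y _; rewrite mulr1.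
by congr (_ * _); apply: eq_bigr => u _; rewrite mulr1.
Qed.

(** * Positivity of the normalising constants *)

Lemma mass_ge0 A (y : Y A) : 0 <= mass A y.
Proof. by case: (r_oracle A). Qed.

(** In [resample_Pr] a product of two masses equals a positive number, so neither factor vanishes.
    The other factor gives [Pr_keep_all_gt0]. *)
Lemma Pr_meet_gt0 s : pairwise nsim s -> 0 < Pr Omega (mem (meet s)).
Proof.
elim: s => [_|A s IHs /= /andP[nAs /IHs s_gt0]].
  suff -> : Pr Omega (mem (meet [::])) = 1 by [].
  by rewrite -(proj2 Omega_distr) meet_nil; apply: eq_bigl => u; rewrite !inE.
rewrite lt0r Pr_ge0 ?andbT => [|u]; last exact: ltW.
apply: contraTneq (mulr_gt0 (ev_gt0 A) s_gt0) => As0.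
by rewrite -resample_Pr // As0 mul0r ltxx.
Qed.

Lemma Pr_keep_all_gt0 A s : all (nsim A) s -> pairwise nsim s ->
  0 < Pr (mass A) (mem (keeps A s)).
Proof.
move=> nAs ps; rewrite lt0r Pr_ge0 ?andbT => [|y]; last exact: mass_ge0.
apply: contraTneq (mulr_gt0 (ev_gt0 A) (Pr_meet_gt0 ps)) => As0.
by rewrite -resample_Pr // As0 mulr0 ltxx.
Qed.

(** * Runs and the product space of draws *)

Lemma eq_run s f g u : f =1 g -> run s f u = run s g u.
Proof.
move=> fg; elim: s u => [|A s IHs] u /=; first exact: fg.
by apply: eq_bigr => y _; rewrite IHs.
Qed.

Lemma run_consE A s f u :
  run (A :: s) f u
  = (\sum_(y in keeps A s) mass A y * run s f (oact u y))
    / Pr (mass A) (mem (keeps A s)).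
Proof. exact: sum_cond. Qed.

Lemma run1 s u : pairwise nsim s -> run s (fun=> 1) u = 1.
Proof.
elim: s u => //= A s IHs u /andP[nAs ps].
have [_ S1] := cond_distr (@mass_ge0 A) (Pr_keep_all_gt0 nAs ps).
rewrite -[RHS]S1; by apply: eq_bigr => y _; rewrite IHs // mulr1.
Qed.

(** Trades the dependent product [seq_space s] for the recursion [run], which may sum over all of
    [ospace r A] because [cond] vanishes off the kept set. *)
Lemma sum_seq_mass s (f : S -> R) u :
  \sum_z @seq_mass R S I ev r s z * f (seq_act u z) = run s f u.
Proof.
elim: s f u => [|A s IHs] f u /=.
  by rewrite (bigD1 tt) //= big1 ?addr0 ?mul1r // => -[].
rewrite -(pair_bigA _ (fun y z => cond (mass A) (keeps A s) (val y) *
   @seq_mass R S I ev r s z * f (seq_act (oact u (val y)) z))) /=.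
transitivity (\sum_(y in keeps A s) cond (mass A) (keeps A s) y * run s f (oact u y)).
  rewrite [RHS]big_sub; apply: eq_bigr => y _; rewrite -IHs mulr_sumr.
  by apply: eq_bigr => z _; rewrite mulrA.
rewrite big_mkcond; apply: eq_bigr => y _; rewrite /cond.
by case: (y \in _); rewrite ?mul0r.
Qed.

Lemma seq_mass_distr s : pairwise nsim s -> is_distr (@seq_mass R S I ev r s).
Proof.
move=> ps; split=> [z|].
  elim: s ps z => [_ _|A s IHs /= /andP[nAs ps] [y z]] //=.
  rewrite /prod_distr mulr_ge0 ?IHs //=.
  by case: (cond_distr (@mass_ge0 A) (Pr_keep_all_gt0 nAs ps)).
(* The total mass is computed as a run of the constant 1, which needs some starting state. *)
have [u _|S0] := pickP S; last first.
  by case: Omega_distr => _; rewrite big_pred0 // => /esym/eqP; rewrite oner_eq0.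
by rewrite -[RHS](run1 u ps) -sum_seq_mass; apply: eq_bigr => z _; rewrite mulr1.
Qed.

(** * (C1), (C2) and (C4) along a run *)

(** Each step turns [Omega] restricted to [meet (A :: s)] into a multiple of [Omega] restricted to
    [meet s]: this is [resample_sum] with the rest of the run as [g]. *)
Lemma run_Omega s f : pairwise nsim s ->
  \sum_(u in meet s) Omega u * run s f u
  = Pr Omega (mem (meet s)) * \sum_u Omega u * f u.
Proof.
elim: s => [_|A s IHs].
  suff -> : Pr Omega (mem (meet [::])) = 1.
    by rewrite mul1r meet_nil; apply: eq_bigl => u; rewrite inE.
  by rewrite -(proj2 Omega_distr) meet_nil; apply: eq_bigl => u; rewrite !inE.
rewrite pairwise_cons => /andP[nAs ps].
have m_neq0 : Pr (mass A) (mem (keeps A s)) != 0.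
  by rewrite gt_eqF ?Pr_keep_all_gt0.
apply: (mulIf m_neq0); rewrite [RHS]mulrAC resample_Pr // -mulrA -IHs //.
rewrite -resample_sum // mulr_suml; apply: eq_bigr => u _.
rewrite run_consE -mulrA mulfVK // mulr_sumr.
by apply: eq_bigr => y _; rewrite mulrA.
Qed.

(* Whether the target is hit depends on the starting state only through
   membership in the target; this yields both (C2) and (C4). *)
Lemma seq_act_meet s t (z : @seq_space R S I ev r s) :
    pairwise nsim s -> allrel nsim s t ->
  exists b : bool, forall u, u \in meet s ->
    (seq_act u z \in meet t) = (u \in meet t) && b.
Proof.
elim: s z => [z _ _|A s IHs [y z]]; first by exists true => u _; rewrite andbT.
rewrite pairwise_cons allrel_consl => /andP[nAs ps] /andP[nAt nst].
have [b IHb] := IHs z ps nst.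
(* The bit records whether every coordinate lies in the kept set for [t]. *)
exists ((val y \in keeps A t) && b) => u.
rewrite in_meet_cons => /andP[uA us] /=.
by rewrite IHb ?oact_meet ?us ?(valP y) // andbA.
Qed.

(** * Concatenation of runs *)

Lemma run_notin s t f u : pairwise nsim s -> allrel nsim s t ->
    u \in meet s -> u \notin meet t ->
  run s (fun v => (v \in meet t)%:R * f v) u = 0.
Proof.
move=> ps nst us /negbTE ut; rewrite -sum_seq_mass big1 // => z _.
by have [b ->] := seq_act_meet z ps nst; rewrite // ut mul0r mulr0.
Qed.

(* [k] is the probability of staying in [<t>], which does not depend on [u]. *)
Lemma run_cat s t : pairwise nsim (s ++ t) ->
  exists2 k, k != 0 & forall f u, u \in meet (s ++ t) ->
    run s (fun v => (v \in meet t)%:R * run t f v) u = k * run (s ++ t) f u.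
Proof.
elim: s => [_|A s IHs]; first by exists 1; rewrite ?oner_eq0 // => f u /= ->.
rewrite cat_cons pairwise_cons => /andP[nAst pst].
have [k k_neq0 IHk] := IHs pst.
move: (pst) (nAst); rewrite pairwise_cat all_cat => /and3P[nst ps pt] /andP[nAs nAt].
have m_neq0 := lt0r_neq0 (Pr_keep_all_gt0 nAst pst).
(* The new factor is the probability that [y], drawn from [keeps A s], also lies in [keeps A t]. *)
exists (k * Pr (mass A) (mem (keeps A (s ++ t))) / Pr (mass A) (mem (keeps A s))).
  rewrite !mulf_neq0 ?invr_eq0 //.
  by have/lt0r_neq0 := Pr_keep_all_gt0 nAs ps.
move=> f u; rewrite in_meet_cons in_meet_cat => /and3P[uA us ut].
rewrite !run_consE mulrAC; congr (_ / _).
rewrite -[RHS]mulrA [X in k * X]mulrCA divff // mulr1 mulr_sumr big_mkcond [RHS]big_mkcond.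
apply: eq_bigr => y _; rewrite keep_all_cat inE.
case: (boolP (y \in keeps A s)) => //= ys.
(* If [y] is not in [keeps A t], the state has left [meet t], and by [run_notin] the remaining run
   never ends there. *)
case: (boolP (y \in keeps A t)) => yt.
  by rewrite IHk 1?mulrCA // in_meet_cat !oact_meet ?us ?ut ?ys.
by rewrite run_notin ?mulr0 // oact_meet ?us ?ut ?ys.
Qed.

(** * Reordering a run by means of (C3) *)

Lemma nsim_sym : symmetric nsim.
Proof. by move=> A B; rewrite sim_sym. Qed.

Lemma pairwise_nsim_perm s t : perm_eq s t -> pairwise nsim s = pairwise nsim t.
Proof.
apply: catCA_perm_subst => s1 s2 s3; rewrite !pairwise_cat !allrel_catr.
have -> : allrel nsim s2 s1 = allrel nsim s1 s2.
  by rewrite allrelC; apply: eq_allrel => A B; rewrite nsim_sym.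
by case: (allrel nsim s1 s2); case: (allrel nsim s1 s3); case: (allrel nsim s2 s3);
   case: (pairwise nsim s1); case: (pairwise nsim s2).
Qed.

(** Among draws with [yu] in [ev B], those ending in [meet s] are exactly those respecting the kept
    sets for [s]. Restricting the conditional law of (C3) to [meet s] thus gives the run up to a
    constant independent of [f]. *)
Lemma run2E A B s u :
    pairwise nsim [:: A, B & s] -> u \in meet [:: A, B & s] ->
  exists c, forall f, run [:: A, B & s] f u = c * \sum_(w in meet s)
    condPr (prod_distr (mass A) (mass B))
      (fun z => oact (oact u z.1) z.2 == w) (fun z => oact u z.1 \in ev B)
    * run s f w.
Proof.
move=> pABs ABs_u; 
have [nAB nAs nBs ps] :
    [/\ ~~ sim A B, all (nsim A) s, all (nsim B) s & pairwise nsim s].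
  by case/and3P: pABs => /andP[].
have /and3P[uA uB us] : [&& u \in ev A, u \in ev B & u \in meet s].
  by move: ABs_u; rewrite !in_meet_cons.
pose p := prod_distr (mass A) (mass B).
pose Q (z : Y A * Y B) := oact u z.1 \in ev B.
have Q_neq0 : Pr p Q != 0.
  suff -> : Pr p Q = Pr (mass A) (mem (keeps A [:: B])).
    by rewrite gt_eqF // Pr_keep_all_gt0 //= nAB.
  rewrite !PrE -(pair_bigA _ (fun y y' => mass A y * mass B y' * (oact u y \in ev B)%:R)).
  apply: eq_bigr => y _; rewrite -mulr_suml -mulr_sumr (proj2 (r_oracle B)) mulr1.
  by rewrite oact_ev // uB /= in_keep_all /= andbT.
(* [Pr p Q] cancels the denominator of [condPr]; the other two factors normalise the draws for [A]
   and [B]. *)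
exists (Pr p Q / (Pr (mass A) (mem (keeps A (B :: s))) * Pr (mass B) (mem (keeps B s)))).
move=> f; rewrite run_consE [RHS]mulrAC [X in _ = _ / X]mulrC.
rewrite [in RHS]invfM [RHS]mulrA; congr (_ / _).
transitivity ((\sum_z p z * (Q z)%:R * ((oact (oact u z.1) z.2 \in meet s)%:R *
    run s f (oact (oact u z.1) z.2))) / Pr (mass B) (mem (keeps B s))).
  rewrite -(pair_bigA _ (fun y y' => mass A y * mass B y' * (oact u y \in ev B)%:R *
    ((oact (oact u y) y' \in meet s)%:R * run s f (oact (oact u y) y')))) /=.
  rewrite mulr_suml big_mkcond; apply: eq_bigr => y _.
  have := @oact_meet A (B :: s) u y; rewrite !in_meet_cons /= nAB uB us => /(_ nAs uA) /= <-.
  case: (boolP (oact u y \in ev B)) => yuB /=; last first.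
    by rewrite big1 ?mul0r // => y' _; rewrite mulr0 mul0r.
  case: (boolP (oact u y \in meet s)) => yus; last first.
    rewrite big1 ?mul0r // => y' _.
    by rewrite oact_meet // (negbTE yus) mul0r mulr0.
  rewrite sum_cond mulrA mulr_sumr big_mkcond; congr (_ / _).
  apply: eq_bigr => y' _; rewrite oact_meet // yus /=.
  by case: ifP => _; rewrite ?mul0r ?mulr0 // mulr1 mul1r mulrA.
rewrite (sum_comp (fun z => p z * (Q z)%:R) (fun z => oact (oact u z.1) z.2)
  (fun w => (w \in meet s)%:R * run s f w)).
congr (_ / _); rewrite mulr_sumr [RHS]big_mkcond.
apply: eq_bigr => w _; case: ifP => _; last by rewrite mul0r mulr0.
rewrite mul1r mulrA; congr (_ * _); rewrite /condPr mulrCA divff // mulr1.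
by rewrite !PrE; apply: eq_bigr => z _; rewrite -mulrA -natrM mulnb andbC.
Qed.

(* Both sides are probability laws on [<s>] that are proportional to the
   conditional laws which (C3) equates, so the constants of [run2E] agree. *)
Lemma run_swap A B s f u : C3 ev sim r ->
    pairwise nsim [:: A, B & s] -> u \in meet [:: A, B & s] ->
  run [:: A, B & s] f u = run [:: B, A & s] f u.
Proof.
move=> r_C3 pABs uABs.
have BAs : perm_eq [:: A, B & s] [:: B, A & s] by rewrite (perm_catCA [:: A] [:: B]).
have pBAs : pairwise nsim [:: B, A & s] by rewrite -(pairwise_nsim_perm BAs).
have uBAs : u \in meet [:: B, A & s] by move: uABs; rewrite !in_meet_cons andbCA.
have [c cE] := run2E pABs uABs; have [d dE] := run2E pBAs uBAs.
have nAB : ~~ sim A B by move: pABs => /= /and3P[/andP[]].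
have uAB : u \in ev A :&: ev B.
  by move: uABs; rewrite !in_meet_cons in_setI => /and3P[-> ->].
pose M g := \sum_(w in meet s) condPr (prod_distr (mass A) (mass B))
  (fun z => oact (oact u z.1) z.2 == w) (fun z => oact u z.1 \in ev B) * run s g w.
(* [run2E] for [B], [A] yields the other side of (C3) with the two coordinates exchanged. *)
have {}dE g : run [:: B, A & s] g u = d * M g.
  rewrite dE; congr (_ * _); apply: eq_bigr => w _; congr (_ * _).
  rewrite (r_C3 _ _ nAB _ uAB) /condPr; congr (_ / _).
    by rewrite -[RHS]Pr_prod_swap.
  by rewrite -[RHS]Pr_prod_swap.
have cM : c * M (fun=> 1) = 1 by rewrite -cE run1.
have dM : d * M (fun=> 1) = 1 by rewrite -dE run1.
have M_neq0 : M (fun=> 1) != 0.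
  by apply: contra_eq_neq cM => ->; rewrite mulr0 eq_sym oner_eq0.
by rewrite cE dE; congr (_ * _); apply: (mulIf M_neq0); rewrite cM dM.
Qed.

(** Kept sets depend only on which items remain, and a kept draw stays inside [meet s], so agreement
    of the tails there suffices. *)
Lemma run_cons_congr A s t f u : s =i t -> all (nsim A) s ->
    (forall v, v \in meet s -> run s f v = run t f v) ->
    u \in meet (A :: s) ->
  run (A :: s) f u = run (A :: t) f u.
Proof.
move=> st nAs eq_st; rewrite in_meet_cons => /andP[uA us].
rewrite !run_consE -(keep_all_mem A st); congr (_ / _).
by apply: eq_bigr => y ys; rewrite eq_st // oact_meet // us.
Qed.

(** [A] moves right through [s] by one adjacent swap at a time. *)
Lemma run_middle A s t f u : C3 ev sim r ->
    pairwise nsim (A :: s ++ t) -> u \in meet (A :: s ++ t) ->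
  run (A :: s ++ t) f u = run (s ++ A :: t) f u.
Proof.
move=> r_C3; elim: s u => [//|B s IHs] u; rewrite !cat_cons => pABst uABst.
have ABst : perm_eq [:: A, B & s ++ t] [:: B, A & s ++ t].
  by rewrite (perm_catCA [:: A] [:: B]).
have := pABst; rewrite (pairwise_nsim_perm ABst) pairwise_cons => /andP[nB pAst].
rewrite run_swap //; apply: run_cons_congr => //.
- by move=> C; rewrite inE !mem_cat inE orbCA.
- by move=> v; apply: IHs.
- by move: uABst; rewrite !in_meet_cons andbCA.
Qed.

(** By induction the tail [s ++ t] becomes [t ++ s], after which [run_middle] moves [A] behind
    [t]. *)
Lemma run_catC s t f u : C3 ev sim r ->
    pairwise nsim (s ++ t) -> u \in meet (s ++ t) ->
  run (s ++ t) f u = run (t ++ s) f u.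
Proof.
move=> r_C3; elim: s u => [|A s IHs] u; first by rewrite cats0.
rewrite cat_cons => pAst uAst.
have /andP[nAst pst] : all (nsim A) (s ++ t) && pairwise nsim (s ++ t).
  by rewrite -pairwise_cons.
rewrite (@run_cons_congr _ _ (t ++ s)) //; last first.
- by move=> v; apply: IHs.
- by move=> C; rewrite !mem_cat orbC.
have Ast : perm_eq (A :: s ++ t) (A :: t ++ s) by rewrite perm_cons perm_catC.
apply: run_middle => //; first by rewrite -(pairwise_nsim_perm Ast).
by move: uAst; rewrite !in_meet_cons !in_meet_cat [in X in _ && X]andbC.
Qed.

(** * Conditional laws as runs *)

Lemma sum_seq_mass2 s t (f : S -> R) u :
  \sum_z prod_distr (@seq_mass R S I ev r s) (@seq_mass R S I ev r t) z
    * ((seq_act u z.1 \in meet t)%:R * f (seq_act (seq_act u z.1) z.2))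
  = run s (fun v => (v \in meet t)%:R * run t f v) u.
Proof.
rewrite -(pair_bigA _ (fun x y => @seq_mass R S I ev r s x * @seq_mass R S I ev r t y
    * ((seq_act u x \in meet t)%:R * f (seq_act (seq_act u x) y)))) -sum_seq_mass.
apply: eq_bigr => x _; rewrite -sum_seq_mass !mulr_sumr.
by apply: eq_bigr => y _; rewrite -mulrA [X in _ = _ * X]mulrCA.
Qed.

(** The factor from [run_cat] appears in the numerator and, by the constant function 1, alone in the
    denominator, so it cancels. *)
Lemma condPr_seq s t u w : pairwise nsim (s ++ t) -> u \in meet (s ++ t) ->
  condPr (prod_distr (@seq_mass R S I ev r s) (@seq_mass R S I ev r t))
    (fun z => seq_act (seq_act u z.1) z.2 == w)
    (fun z => seq_act u z.1 \in meet t)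
  = run (s ++ t) (fun v => (v == w)%:R) u.
Proof.
move=> pst ust; have [k k_neq0 runE] := run_cat pst.
suff PrE' f : \sum_z prod_distr (@seq_mass R S I ev r s) (@seq_mass R S I ev r t) z
    * ((seq_act u z.1 \in meet t)%:R * f (seq_act (seq_act u z.1) z.2))
    = k * run (s ++ t) f u.
  rewrite /condPr; have -> : forall a b, a = k * run (s ++ t) (fun v => (v == w)%:R) u ->
      b = k -> a / b = run (s ++ t) (fun v => (v == w)%:R) u => //.
  - by move=> a b -> ->; rewrite mulrAC divff // mul1r.
  - rewrite -PrE' PrE; apply: eq_bigr => z _; congr (_ * _).
    by rewrite -natrM mulnb andbC.
  - rewrite -[RHS]mulr1 -(run1 u pst) -PrE' PrE; apply: eq_bigr => z _.
    by rewrite mulr1.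
by rewrite sum_seq_mass2 runE.
Qed.

End SequentialResampling.

(** * Transfer to the atomic extension *)

Theorem mainTheorem1 (R : realFieldType)
  (S : finType) (Omega : S -> R)
  (Omega_distr : is_distr Omega) (Omega_pos : forall u : S, 0 < Omega u)
  (I : finType) (ev : I -> {set S}) (sim : rel I) (sim_sym : symmetric sim)
  (r : oracle R S I) (r_oracle : is_oracle r)
  (ord : atomic_idx sim -> seq I)
  (ord_perm : forall C : atomic_idx sim, perm_eq (ord C) (enum (val C))) :
  C1 Omega ev r -> C2 ev sim r -> C4 Omega ev sim r ->
  let aev := @atomic_ev S I ev sim in
  let asim := @atomic_sim I sim in
  let ar := @atomic_oracle R S I ev sim r ord in
  (is_oracle ar /\ C1 Omega aev ar /\ C2 aev asim ar /\ C4 Omega aev asim ar)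
  /\ (C3 ev sim r -> C3 aev asim ar).
Proof.
move=> r_C1 r_C2 r_C4 aev asim ar.
have mem_ord C A : (A \in ord C) = (A \in val C).
  by rewrite (perm_mem (ord_perm C)) mem_enum.
(* [independent] constrains distinct events only; [ord_perm] excludes repetitions in the
   ordering. *)
have ord_pairwise C : pairwise (fun A B => ~~ sim A B) (ord C).
  apply: (@sub_in_pairwise _ (mem (val C)) [rel A B | A != B]).
  - move=> A B AC BC /= nAB.
    by move/forall_inP: (valP C) => /(_ A AC) /forall_inP /(_ B BC) /implyP; apply.
  - by apply/allP => A; rewrite mem_ord.
  - by rewrite -uniq_pairwise (perm_uniq (ord_perm C)) enum_uniq.
have ord_allrel C C' : ~~ asim C C' -> allrel (fun A B => ~~ sim A B) (ord C) (ord C').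
  move=> nCC'; apply/allrelP => A B; rewrite !mem_ord => AC BC'.
  apply: contra nCC' => sAB; apply/exists_inP; exists A => //.
  by apply/exists_inP; exists B.
have aevE C : aev C = meet ev (ord C).
  apply/setP => u; apply/bigcapP/meetP => uC A; first by rewrite mem_ord; apply: uC.
  by rewrite -mem_ord; apply: uC.
split.
  split=> [C|]; first exact:
    (seq_mass_distr Omega_distr Omega_pos r_oracle r_C1 r_C2 r_C4 (ord_pairwise C)).
  split=> [C w|].
    pose delta u : R := (u == w)%:R.
    rewrite PrE -(pair_bigA _ (fun u y => cond Omega (aev C) u *
      @seq_mass R S I ev r (ord C) y * delta (seq_act u y))) /=.
    transitivity (\sum_u cond Omega (aev C) u * run ev r (ord C) delta u).
      apply: eq_bigr => u _; rewrite -sum_seq_mass mulr_sumr.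
      by apply: eq_bigr => y _; rewrite mulrA.
    rewrite sum_cond aevE.
    rewrite (run_Omega Omega_distr Omega_pos r_oracle r_C1 r_C2 r_C4) //.
    rewrite mulrAC divff ?mul1r.
      rewrite (bigD1 w) //= /delta eqxx mulr1 big1 ?addr0 // => u /negbTE ->.
      by rewrite mulr0.
    by rewrite gt_eqF // (Pr_meet_gt0 Omega_distr Omega_pos r_C1 r_C2 r_C4).
  (* One bit per [y] serves both remaining properties: (C2) starts outside [aev C'], (C4) inside
     it. *)
  have hit C C' (y : ospace ar C) : ~~ asim C C' -> exists b : bool, forall u, u \in aev C ->
      (oact u y \in aev C') = (u \in aev C') && b.
    move=> nCC'; rewrite !aevE.
    exact: (seq_act_meet Omega_pos r_C2 r_C4 _ (ord_pairwise C) (ord_allrel _ _ nCC')).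
  split=> [C C' nCC' u | C C' nCC' y].
    rewrite inE => /andP[/negbTE uC' uC] y.
    by have [b ->] := hit C C' y nCC'; rewrite // uC'.
  have [b hitE] := hit C C' y nCC'.
  rewrite PrE sum_cond; case: b hitE => hitE; [right | left].
    have V_gt0 : 0 < Pr Omega (mem (aev C :&: aev C')).
      have pCC' : pairwise (fun A B => ~~ sim A B) (ord C ++ ord C').
        by rewrite pairwise_cat ord_allrel ?ord_pairwise.
      have := Pr_meet_gt0 Omega_distr Omega_pos r_C1 r_C2 r_C4 pCC'.
      congr (0 < _); apply: eq_bigl => u.
      by rewrite !aevE; rewrite /= [in RHS]in_setI -in_meet_cat.
    apply: (mulIf (lt0r_neq0 V_gt0)); rewrite mulfVK ?lt0r_neq0 // mul1r.
    apply: eq_bigr => u; rewrite inE => /andP[uC uC'].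
    by rewrite hitE // uC' mulr1.
  rewrite big1 ?mul0r // => u; rewrite inE => /andP[uC uC'].
  by rewrite hitE // andbF mulr0.
move=> r_C3 C C' nCC' u; rewrite inE !aevE -in_meet_cat => uCC' w.
have pCC' : pairwise (fun A B => ~~ sim A B) (ord C ++ ord C').
  by rewrite pairwise_cat ord_allrel ?ord_pairwise.
have pC'C : pairwise (fun A B => ~~ sim A B) (ord C' ++ ord C).
  by rewrite (pairwise_nsim_perm sim_sym (t := ord C ++ ord C')) // perm_catC.
(* Both sides of (C3) are runs through concatenations, which [run_catC] exchanges. *)
rewrite (condPr_seq Omega_distr Omega_pos r_oracle r_C1 r_C2 r_C4) //.
rewrite (run_catC Omega_distr Omega_pos sim_sym r_oracle r_C1 r_C2 r_C4) //.
rewrite -(condPr_seq Omega_distr Omega_pos r_oracle r_C1 r_C2 r_C4) //; last first.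
  by move: uCC'; rewrite !in_meet_cat andbC.
by rewrite /condPr; congr (_ / _); rewrite -[RHS]Pr_prod_swap.
Qed.
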